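(* Let $\mathcal{C}$ be a linear $(n,k,d)(\kappa,\delta)$-LRC over the finite field $\mathbb{F}_q$ (that is, an $[n,k,d]$ linear code over $\mathbb{F}_q$ with all-symbol dimension-locality $(\kappa,\delta)$, where $\kappa,\delta$ are positive integers). Then $$k \leq \min_{\lambda \in \mathbb{Z}_{+}} \left\{ \lambda + k_{\mathrm{opt}}^{(q)}\bigl(n-(a+1)\,\mathcal{G}(\kappa, \delta) + \mathcal{G}(\kappa - b, \delta),\, d \bigr) \right\},$$ where, for each $\lambda$, the integers $a,b$ are determined by $\lambda = a \kappa + b$, $0 \leq b < \kappa$.
   Context: $\mathbb{Z}_+=\{0,1,2,\dots\}$ and $[n]=\{1,\dots,n\}$. An $[n,k,d]$ linear code over $\mathbb{F}_q$ has length $n$, dimension $k\ge 1$ and minimum (Hamming) distance $d$. For $I\subseteq[n]$, $\mathcal{C}|_I=\{\mathbf{c}_I:\mathbf{c}\in\mathcal{C}\}$ is the restriction of $\mathcal{C}$ to the coordinates in $I$, and $H(I)=\log_q|\mathcal{C}|_I|=\dim\mathcal{C}|_I$. The zero code is regarded as having infinite minimum distance. Dimension-locality: an $[n,k,d]$ linear code $\mathcal{C}$ has all-symbol dimension-locality $(\kappa,\delta)$ if for every $i\in[n]$ there is a set $R\subseteq[n]$ (a repair set) with (1) $i\in R$, (2) $H(R)\le\kappa$, (3) the minimum distance of $\mathcal{C}|_R$ is at least $\delta$. Griesmer function over $\mathbb{F}_q$: $\mathcal{G}(k,d)=\sum_{i=0}^{k-1}\lceil d/q^i\rceil$ (so $\mathcal{G}(0,d)=0$).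 $k_{\mathrm{opt}}^{(q)}(m,d)$ is the largest dimension of a linear code over $\mathbb{F}_q$ of length $m$ and minimum distance at least $d$; it equals $0$ if there is no such nonzero code (in particular if $m<d$, including $m\le 0$). *)

(* Defs.v *)
From HB Require Import structures.
From mathcomp Require Import all_boot all_order all_algebra.
From mathcomp Require Import boolp.

Set Implicit Arguments.
Unset Strict Implicit.
Unset Printing Implicit Defensive.

Import Order.TTheory GRing.Theory Num.Theory.

Local Open Scope ring_scope.

Section Codes.
Variable F : finFieldType.

Definition hamming_dist n (x y : 'rV[F]_n) : nat :=
  #|[set i | x 0 i != y 0 i]|.

(* Vacuously true for the zero code, whose minimum distance is infinite. *)
Definition min_dist_ge n (C : {vspace 'rV[F]_n}) (d : nat) : Prop :=
  forall x y, x \in C -> y \in C -> x != y -> (d <= hamming_dist x y)%N.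

Definition min_dist_eq n (C : {vspace 'rV[F]_n}) (d : nat) : Prop :=
  min_dist_ge C d /\
  exists x y, [/\ x \in C, y \in C, x != y & hamming_dist x y = d].

Definition linear_code n (C : {vspace 'rV[F]_n}) (k d : nat) : Prop :=
  [/\ (1 <= k)%N, \dim C = k & min_dist_eq C d].

(* The coordinates of I are renumbered increasingly, so that the restricted
   code has length #|I|. *)
Definition restr n (I : {set 'I_n}) (x : 'rV[F]_n) : 'rV[F]_#|I| :=
  \row_(j < #|I|) x 0 (enum_val j).

Lemma restr_is_linear n (I : {set 'I_n}) : linear (@restr n I).
Proof. by move=> a x y; apply/rowP => j; rewrite !mxE. Qed.

HB.instance Definition _ n (I : {set 'I_n}) :=
  GRing.isLinear.Build F 'rV[F]_n 'rV[F]_#|I| _ (@restr n I)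
    (restr_is_linear I).

Definition restr_code n (C : {vspace 'rV[F]_n}) (I : {set 'I_n}) :
  {vspace 'rV[F]_#|I|} := (linfun (@restr n I) @: C)%VS.

Lemma mem_restr_code n (C : {vspace 'rV[F]_n}) (I : {set 'I_n}) y :
  reflect (exists2 x, x \in C & y = restr I x) (y \in restr_code C I).
Proof.
apply: (iffP memv_imgP) => -[x xC ->]; exists x => //; by rewrite lfunE.
Qed.

Definition dim_locality n (C : {vspace 'rV[F]_n}) (kappa delta : nat) : Prop :=
  forall i : 'I_n, exists R : {set 'I_n},
    [/\ i \in R, (\dim (restr_code C R) <= kappa)%N
      & min_dist_ge (restr_code C R) delta].

(* The zero code makes j = 0 always admissible. *)
Definition kopt_nat (m d : nat) : nat :=
  \max_(j < m.+1 | `[< exists2 C : {vspace 'rV[F]_m},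
                         \dim C = j & min_dist_ge C d >]) j.

Definition kopt (m : int) (d : nat) : nat :=
  if m is Posz m' then kopt_nat m' d else 0%N.

End Codes.

Definition griesmer (q k d : nat) : int :=
  \sum_(0 <= i < k) Num.ceil (d%:R / q%:R ^+ i : rat).

Lemma range_nonempty (f : nat -> nat) :
  exists v : nat, `[< exists l : nat, f l = v >].
Proof. by exists (f 0%N); apply/asboolP; exists 0%N. Qed.

Definition min_nat (f : nat -> nat) : nat := ex_minn (range_nonempty f).

Lemma leq_min_nat (f : nat -> nat) (m : nat) :
  (m <= min_nat f)%N <-> forall l, (m <= f l)%N.
Proof.
rewrite /min_nat; case: ex_minnP => v /asboolP[l <-] minf; split=> [le_m l'|].
  by apply: leq_trans le_m (minf _ _); apply/asboolP; exists l'.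
by apply.
Qed.

(* Main.v *)
(** Shortening C on a coordinate set I with H(I) <= lambda leaves a code of
    dimension at least k - lambda, length n - |I| and distance at least d, so it
    is enough to find such an I with |I| = (a+1) G(kappa) - G(kappa - b), where
    G(h) is the sum of the h first terms g_0 >= g_1 >= ... of the Griesmer sum
    for delta.

    I is built greedily.  Adding a repair set R that raises the dimension by h
    adds |R \ I| coordinates; the words of C|_R vanishing on I form a code of
    dimension h and distance at least delta there, so |R \ I| >= G(h).  When the
    last repair set would overshoot lambda, only part of it is taken: iterating
    residual codes yields, in a code of dimension h, a coordinate set of
    dimension at most r and size at least G(h) - G(h - r).

    The target size is the sum of the lambda first terms of the periodic sequence
    g_(kappa-1), ..., g_0, g_(kappa-1), ....  Any window of h <= kappa consecutive
    terms has distinct indices, so its sum is at most G(h).  The estimate must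
    count the partial step first, since only the initial r terms of the sequence
    are bounded by G(h) - G(h - r). *)

Require Import Defs.
From mathcomp Require Import all_boot all_order all_algebra.
From mathcomp Require Import zify.

Set Implicit Arguments.
Unset Strict Implicit.
Unset Printing Implicit Defensive.

Import Order.TTheory GRing.Theory Num.Theory.

Local Open Scope ring_scope.

(** * Ceiling division and Griesmer sums *)

Definition ceil_div (d m : nat) : nat := ((d + m.-1) %/ m)%N.

Lemma ceil_div_leq d m x : (0 < m)%N -> (ceil_div d m <= x)%N = (d <= x * m)%N.
Proof.
move=> m_gt0; rewrite /ceil_div -ltnS ltn_divLR // mulSn.
by case: m m_gt0 => // m _; rewrite /= addSn ltnS addnC leq_add2l.
Qed.

Lemma ceil_div1 d : ceil_div d 1 = d.
Proof. by rewrite /ceil_div addn0 divn1. Qed.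

Lemma ceil_divA d m p : (0 < m)%N -> (0 < p)%N ->
  ceil_div (ceil_div d m) p = ceil_div d (m * p).
Proof.
move=> m_gt0 p_gt0.
have le_iff x : (ceil_div (ceil_div d m) p <= x)%N = (ceil_div d (m * p) <= x)%N.
  by rewrite !ceil_div_leq ?muln_gt0 ?m_gt0 // -mulnA [(p * m)%N]mulnC.
by apply/eqP; rewrite eqn_leq le_iff leqnn -le_iff leqnn.
Qed.

Lemma ceil_ratE (d m : nat) : (0 < m)%N ->
  Num.ceil (d%:R / m%:R : rat) = (ceil_div d m)%:Z.
Proof.
move=> m_gt0; have mR : (0 : rat) < m%:R by rewrite ltr0n.
apply/eqP; rewrite eq_le; apply/andP; split.
  rewrite ceil_le_int ler_pdivrMr // -natrM ler_nat.
  by rewrite -ceil_div_leq.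
have: 0 <= Num.ceil (d%:R / m%:R : rat).
  by rewrite ceil_ge0 (lt_le_trans (ltrN10 _)) // divr_ge0 ?ler0n.
have := ceil_ge (d%:R / m%:R : rat).
case: (Num.ceil _) => // x; rewrite ler_pdivrMr // => le_x _.
by rewrite lez_nat ceil_div_leq // -(ler_nat rat) natrM.
Qed.

Definition griesmer_nat (q k d : nat) : nat := \sum_(i < k) ceil_div d (q ^ i).

Lemma griesmerE q k d : (0 < q)%N -> griesmer q k d = (griesmer_nat q k d)%:Z.
Proof.
move=> q_gt0; rewrite /griesmer /griesmer_nat big_mkord.
rewrite (big_morph Posz PoszD (erefl _)); apply: eq_bigr => i _.
by rewrite -natrX ceil_ratE ?expn_gt0 ?q_gt0.
Qed.

(** Nested ceilings merge, so the terms after the first form the Griesmer sum for [ceil_div d q],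
    the distance guaranteed in a residual code. *)
Lemma griesmer_natS q k d : (0 < q)%N ->
  griesmer_nat q k.+1 d = (d + griesmer_nat q k (ceil_div d q))%N.
Proof.
move=> q_gt0; rewrite /griesmer_nat big_ord_recl expn0 ceil_div1.
by congr addn; apply: eq_bigr => i _; rewrite ceil_divA ?expn_gt0 ?q_gt0 // -expnS.
Qed.

Lemma ceil_div_expn_anti q d i j : (0 < q)%N -> (i <= j)%N ->
  (ceil_div d (q ^ j) <= ceil_div d (q ^ i))%N.
Proof.
move=> q_gt0 le_ij; rewrite ceil_div_leq ?expn_gt0 ?q_gt0 //.
have := leqnn (ceil_div d (q ^ i)).
rewrite {1}ceil_div_leq ?expn_gt0 ?q_gt0 // => /leq_trans; apply.
by rewrite leq_mul2l leq_pexp2l ?orbT.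
Qed.

(** * Partial sums of the periodic sequence *)

Section CyclicSums.
Variables (g : nat -> nat) (kappa : nat).
Hypothesis g_anti : forall i j, (i <= j)%N -> (g j <= g i)%N.

Definition cyclic_sum (l : nat) : nat := \sum_(t < l) g (kappa.-1 - t %% kappa).

Lemma leq_sum_uniq_anti (s : seq nat) : uniq s ->
  (\sum_(i <- s) g i <= \sum_(i < size s) g i)%N.
Proof.
move sz_s: (size s) => h; elim: h s sz_s => [|h IHh] s sz_s s_uniq.
  by rewrite (size0nil sz_s) big_nil.
(* By pigeonhole, [h.+1] distinct indices cannot all lie below [h]; a term of index at least [h] is
   at most [g h]. *)
have /hasP[x xs le_hx]: has (leq h) s.
  apply: contraT; rewrite -all_predC => /allP s_lt.
  have: (size s <= size (iota 0 h))%N.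
    apply: uniq_leq_size => // y /s_lt /=.
    by rewrite mem_iota -ltnNge.
  by rewrite sz_s size_iota ltnn.
rewrite (perm_big _ (perm_to_rem xs)) big_cons big_ord_recr /= addnC.
by rewrite leq_add ?g_anti // IHh ?rem_uniq // size_rem // sz_s.
Qed.

Lemma cyclic_sumD s h : (h <= kappa)%N ->
  (cyclic_sum (s + h) <= cyclic_sum s + \sum_(i < h) g i)%N.
Proof.
move=> le_hk; rewrite /cyclic_sum big_split_ord /= leq_add2l.
set w := [seq (kappa.-1 - (s + t) %% kappa)%N | t <- iota 0 h].
have -> : (\sum_(i < h) g (kappa.-1 - (s + i) %% kappa) = \sum_(i <- w) g i)%N.
  rewrite big_map -(big_mkord xpredT (fun i => g (kappa.-1 - (s + i) %% kappa)%N)).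
  by rewrite /index_iota subn0.
have -> : (\sum_(i < h) g i = \sum_(i < size w) g i)%N by rewrite size_map size_iota.
apply: leq_sum_uniq_anti; rewrite map_inj_in_uniq ?iota_uniq // => i j.
rewrite !mem_iota !add0n /= => lt_ih lt_jh eq_ij.
have kappa_gt0 : (0 < kappa)%N by lia.
have lt_i := ltn_pmod (s + i) kappa_gt0; have lt_j := ltn_pmod (s + j) kappa_gt0.
have: (s + i = s + j %[mod kappa])%N by lia.
move/eqP; rewrite eqn_modDl !modn_small; [by move/eqP | lia | lia].
Qed.

(** Read backwards, the initial terms are [g (kappa - r)], ..., [g (kappa - 1)]; since [h <= kappa],
    they are termwise at most [g (h - r)], ..., [g (h - 1)]. *)
Lemma leq_cyclic_sum_tail r h : (r <= h)%N -> (h <= kappa)%N ->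
  (cyclic_sum r + \sum_(i < h - r) g i <= \sum_(i < h) g i)%N.
Proof.
move=> le_rh le_hk; have -> : (\sum_(i < h) g i = \sum_(i < h - r + r) g i)%N by rewrite subnK.
rewrite big_split_ord /= addnC leq_add2l.
rewrite /cyclic_sum (reindex_inj rev_ord_inj) /=; apply: leq_sum => i _.
by apply: g_anti; rewrite modn_small; have := ltn_ord i; lia.
Qed.

(** The value [b = kappa] is included so that the induction can pass from the end of one period to
    the start of the next. *)
Lemma cyclic_sumE a b : (b <= kappa)%N ->
  (cyclic_sum (a * kappa + b) + \sum_(i < kappa - b) g i
   = a.+1 * \sum_(i < kappa) g i)%N.
Proof.
elim: a b => [|a IHa]; elim=> [|b IHb] le_bk.
- by rewrite /cyclic_sum big_ord0 subn0 mul1n.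
- rewrite -IHb 1?ltnW // /cyclic_sum addnS big_ord_recr /= -addnA; congr addn.
  rewrite modnMDl modn_small // -(subnSK le_bk) big_ord_recr addnC /=.
  by congr (_ + g _)%N; lia.
- rewrite addn0 subn0 mulSn [in RHS]mulSn -(IHa kappa) // subnn big_ord0 addn0.
  by rewrite addnC [(kappa + _)%N]addnC.
- rewrite -IHb 1?ltnW // /cyclic_sum addnS big_ord_recr /= -addnA; congr addn.
  rewrite modnMDl modn_small // -(subnSK le_bk) big_ord_recr addnC /=.
  by congr (_ + g _)%N; lia.
Qed.

End CyclicSums.

(** * Shortenings and restrictions *)

Section Shortening.
Variables (F : finFieldType) (n : nat).
Implicit Types (C D : {vspace 'rV[F]_n}) (S I J R : {set 'I_n}) (x y : 'rV[F]_n).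

Definition weight_on S x : nat := #|[set i in S | x 0 i != 0]|.

(** The coordinates in [S] are not deleted, so that successive shortenings are subspaces of one
    space; the codimension in [D] is H(S). *)
Definition shortening D S : {vspace 'rV[F]_n} :=
  (D :&: lker (linfun (@restr F n S)))%VS.

Lemma restr_eq0P S x : reflect {in S, forall i, x 0 i = 0} (restr S x == 0).
Proof.
apply: (iffP eqP) => [x0 i iS | x0].
  by have /rowP/(_ (enum_rank_in iS i)) := x0; rewrite !mxE enum_rankK_in.
by apply/rowP => j; rewrite !mxE x0 // enum_valP.
Qed.

Lemma shorteningP D S x :
  reflect (x \in D /\ {in S, forall i, x 0 i = 0}) (x \in shortening D S).
Proof.
rewrite memv_cap memv_ker lfunE.
by apply: (iffP andP) => -[xD /restr_eq0P].
Qed.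

Lemma shortening_sub D S : (shortening D S <= D)%VS.
Proof. exact: capvSl. Qed.

Lemma shorteningS D S J : J \subset S -> (shortening D S <= shortening D J)%VS.
Proof.
move=> /subsetP sJS; apply/subvP=> x /shorteningP[xD x0].
by apply/shorteningP; split=> // i /sJS /x0.
Qed.

Lemma shorteningU D S J :
  shortening (shortening D S) J = shortening D (S :|: J).
Proof.
apply/vspaceP=> x; apply/shorteningP/shorteningP.
  case=> /shorteningP[xD x0S] x0J; split=> // i.
  by rewrite inE => /orP[/x0S|/x0J].
case=> xD x0; split; first apply/shorteningP; [split=> // | ] => i iS;
  by rewrite x0 // inE iS ?orbT.
Qed.

Lemma shortening_set0 D : shortening D set0 = D.
Proof.
apply/eqP; rewrite eqEsubv shortening_sub; apply/subvP=> x xD.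
by apply/shorteningP; split=> // i; rewrite inE.
Qed.

Lemma dim_restr_code C S :
  (\dim (shortening C S) + \dim (restr_code C S) = \dim C)%N.
Proof. exact: limg_ker_dim. Qed.

Lemma weight_restr S x : hamming_dist (restr S x) 0 = weight_on S x.
Proof.
rewrite /hamming_dist /weight_on -(card_imset _ enum_val_inj).
apply: eq_card => i; rewrite inE; apply/imsetP/andP => [[j] | [iS xi]].
  by rewrite inE !mxE => xj ->; rewrite enum_valP.
by exists (enum_rank_in iS i); rewrite ?inE ?mxE enum_rankK_in.
Qed.

Lemma min_dist_restr C S d x : min_dist_ge (restr_code C S) d ->
  x \in C -> x \notin shortening C S -> (d <= weight_on S x)%N.
Proof.
move=> dC xC xS; rewrite -weight_restr; apply: dC; rewrite ?mem0v //.
  by apply/mem_restr_code; exists x.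
by apply: contra xS => /restr_eq0P x0; apply/shorteningP.
Qed.

Lemma notin_shortening_neq0 D S x :
  x \in D -> x \notin shortening D S -> exists2 i, i \in S & x 0 i != 0.
Proof.
move=> xD xS; apply/exists_inP; apply: contraR xS.
rewrite negb_exists_in => /forall_inP x0.
by apply/shorteningP; split=> // i /x0; rewrite negbK => /eqP.
Qed.

(** * Residual codes and the Griesmer bound *)

Definition zeros_on S x : {set 'I_n} := [set i in S | x 0 i == 0].

Lemma card_zeros_on S x : (#|zeros_on S x| + weight_on S x = #|S|)%N.
Proof.
rewrite -(cardsID [set i | x 0 i == 0] S); congr addn; apply: eq_card => i;
  by rewrite !inE // andbC.
Qed.

(** Where [x] vanishes, no [c] changes [y]; elsewhere exactly one [c], namely [y 0 i / x 0 i],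
    produces a zero. *)
Lemma sum_weight_on S x y :
  (\sum_(c : F) weight_on S (y - c *: x) =
   #|F| * weight_on (zeros_on S x) y + #|F|.-1 * weight_on S x)%N.
Proof.
have weightE T z : weight_on T z = (\sum_(i in T) (z 0%R i != 0%R))%N.
  rewrite /weight_on -sum1_card big_mkcond [RHS]big_mkcond.
  by apply: eq_bigr => i _; rewrite inE; case: (i \in T); case: (z 0 i == 0).
under eq_bigr do rewrite weightE.
rewrite exchange_big !weightE !big_distrr /=.
rewrite (bigID (fun i => x 0 i == 0)) /=; congr addn.
  apply: eq_big => [i | i /andP[_ /eqP xi]]; first by rewrite inE.
  under eq_bigr do rewrite !mxE xi mulr0 subr0.
  by rewrite sum_nat_const.
rewrite [RHS](bigID (fun i => x 0 i == 0)) /= [X in (X + _)%N]big1 ?add0n.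
  apply: eq_bigr => i /andP[_ xi]; rewrite xi muln1 -(cardC1 (y 0 i / x 0 i)).
  rewrite -sum1_card [RHS]big_mkcond; apply: eq_bigr => c _.
  by rewrite !mxE inE /= subr_eq0 eq_sym -[c == _](inj_eq (mulIf xi)) divfK.
by move=> i /andP[_ ->]; rewrite muln0.
Qed.

Lemma shortening_zeros_on D S x : x \in D ->
  x \notin shortening D S ->
  {in D, forall y, y \notin shortening D S -> weight_on S x <= weight_on S y}%N ->
  \dim (shortening D (zeros_on S x)) = (\dim (shortening D S)).+1.
Proof.
move=> xD xS min_x; have [i iS xi] := notin_shortening_neq0 xD xS.
have -> : shortening D (zeros_on S x) = (shortening D S + <[x]>)%VS.
  apply/eqP; rewrite eqEsubv; apply/andP; split; last first.
    rewrite subv_add shorteningS /=; last by apply/subsetP=> j /setIdP[].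
    by rewrite -memvE; apply/shorteningP; split=> // j; rewrite inE => /andP[_ /eqP].
  (* On [S], [y - c *: x] is supported in the support of [x] and vanishes at [i], so it is lighter
     than [x]; by minimality it lies in [shortening D S]. *)
  apply/subvP=> y /shorteningP[yD y0]; pose c := y 0 i / x 0 i.
  rewrite -(subrK (c *: x) y) memv_add ?memvZ ?memv_line //.
  have zD : y - c *: x \in D by rewrite memvB ?memvZ.
  apply: contraT => /(min_x _ zD); rewrite leqNgt => /negP[].
  apply: proper_card; apply/properP; split.
    apply/subsetP=> j; rewrite !inE !mxE => /andP[jS zj]; rewrite jS.
    apply: contra zj => /eqP xj; rewrite xj mulr0 subr0.
    by rewrite y0 // inE jS xj eqxx.
  by exists i; rewrite !inE ?iS // !mxE divfK // subrr eqxx.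
rewrite dimv_disjoint_sum.
  rewrite dim_vline; case: eqP xS => [->|_ _]; last by rewrite addn1.
  by rewrite mem0v.
apply/eqP; rewrite -subv0; apply/subvP=> y; rewrite memv_cap memv0.
case/andP=> yS /vlineP[c def_y]; rewrite def_y scaler_eq0.
apply: contraR xS; rewrite negb_or => /andP[c0 _].
by rewrite -(scalerK c0 x) memvZ // -def_y.
Qed.

(* All the y - c x have the same values as y on the zeros of x, so none of them
   lies in the shortening; average their weights over c. *)
Lemma weight_residual D S x y : x \in D -> y \in D ->
  {in D, forall z, z \notin shortening D S -> weight_on S x <= weight_on S z}%N ->
  y \notin shortening D (zeros_on S x) ->
  (weight_on S x <= weight_on (zeros_on S x) y * #|F|)%N.
Proof.
move=> xD yD min_x y_res.
have le_w c : (weight_on S x <= weight_on S (y - c *: x))%N.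
  apply: min_x; first by rewrite memvB ?memvZ.
  apply: contra y_res => /shorteningP[_ z0]; apply/shorteningP; split=> // i.
  rewrite inE => /andP[iS /eqP xi]; have := z0 i iS.
  by rewrite !mxE xi mulr0 subr0.
have : (\sum_(c : F) weight_on S x <= \sum_(c : F) weight_on S (y - c *: x))%N.
  by apply: leq_sum => c _.
rewrite sum_weight_on sum_nat_const.
have: (0 < #|F|)%N by apply/card_gt0P; exists 0.
by case: #|F| => // q _ /=; rewrite mulSn leq_add2r mulnC.
Qed.

(* Induction on residual codes: restrict to the zeros of a word x of least nonzero
   weight on S. The case [b = h] is the Griesmer bound itself. *)
Lemma griesmer_subset D S delta h b :
  (\dim (shortening D S) + h = \dim D)%N -> (b <= h)%N ->
  {in D, forall x, x \notin shortening D S -> delta <= weight_on S x}%N ->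
  exists J, [/\ J \subset S, (\dim D <= \dim (shortening D J) + b)%N &
    (griesmer_nat #|F| h delta <= #|J| + griesmer_nat #|F| (h - b) delta)%N].
Proof.
have q_gt0 : (0 < #|F|)%N by apply/card_gt0P; exists 0.
elim: h S delta b => [|h IHh] S delta b dimS le_bh wtS.
  exists set0; rewrite sub0set shortening_set0 leq_addr; split=> //.
  by rewrite /griesmer_nat big_ord0.
have [x0 x0D x0S] : exists2 x, x \in D & x \notin shortening D S.
  apply/subvPn; apply/negP=> /dimvS; lia.
pose P x := (x \in D) && (x \notin shortening D S).
have Px0 : P x0 by rewrite /P x0D.
case: (arg_minnP (weight_on S) Px0) => x /andP[xD xS] min_P.
have min_x : {in D, forall y, y \notin shortening D S ->
    (weight_on S x <= weight_on S y)%N}.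
  by move=> y yD yS; apply: min_P; rewrite /P yD.
have le_wx := wtS x xD xS.
have dim_res : (\dim (shortening D (zeros_on S x)) + h = \dim D)%N.
  by rewrite (shortening_zeros_on xD xS min_x) addSnnS.
have wt_res : {in D, forall y, y \notin shortening D (zeros_on S x) ->
    (ceil_div delta #|F| <= weight_on (zeros_on S x) y)%N}.
  move=> y yD y_res; rewrite ceil_div_leq //.
  exact: leq_trans le_wx (weight_residual xD yD min_x y_res).
have zeros_sub : zeros_on S x \subset S by apply/subsetP=> i /setIdP[].
have cardS := card_zeros_on S x.
rewrite griesmer_natS //; move: le_bh; rewrite leq_eqVlt ltnS => /predU1P[->|le_bh].
  (* [S] itself serves: its zeros of [x] number at least the residual Griesmer sum, and the support
     of [x] adds at least [delta]. *)
  exists S; rewrite subnn dimS; split=> //.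
  have [J [sJ _ cardJ]] := IHh _ _ h dim_res (leqnn h) wt_res.
  have := subset_leq_card sJ.
  move: cardJ; rewrite subnn /griesmer_nat !big_ord0; lia.
(* The leading term [delta] now occurs on both sides, so the set found in the residual code
   suffices. *)
have [J [sJ dimJ cardJ]] := IHh _ _ b dim_res le_bh wt_res.
exists J; split=> //; first exact: subset_trans sJ zeros_sub.
by rewrite subSn // griesmer_natS // addnCA leq_add2l.
Qed.

Lemma griesmer_length D S delta h :
  (\dim (shortening D S) + h = \dim D)%N ->
  {in D, forall x, x \notin shortening D S -> delta <= weight_on S x}%N ->
  (griesmer_nat #|F| h delta <= #|S|)%N.
Proof.
move=> dimS wtS; have [J [sJ _]] := griesmer_subset dimS (leqnn h) wtS.
rewrite subnn [X in (_ + X)%N]big_ord0 addn0 => /leq_trans; apply.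
exact: subset_leq_card.
Qed.

(** Shortened words vanish on [I], so deleting these coordinates preserves dimension and
    distances. *)
Lemma shortening_kopt C I d : min_dist_ge C d ->
  (\dim (shortening C I) <= kopt_nat F #|~: I| d)%N.
Proof.
move=> dC; set E := restr_code (shortening C I) (~: I).
have dimE : \dim E = \dim (shortening C I).
  rewrite -(dim_restr_code _ (~: I)) shorteningU setUCr.
  suff -> : shortening C setT = 0%VS by rewrite dimv0.
  apply/eqP; rewrite -subv0; apply/subvP=> x /shorteningP[_ x0].
  by rewrite memv0; apply/eqP/rowP=> i; rewrite x0 ?inE // mxE.
have dE : min_dist_ge E d.
  move=> y z /mem_restr_code[u uI ->] /mem_restr_code[v vI ->] neq_uv.
  have /shorteningP[uC u0] := uI; have /shorteningP[vC v0] := vI.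
  apply: leq_trans (dC u v uC vC _) _; first by apply: contraNneq neq_uv => ->.
  rewrite /hamming_dist -[X in (_ <= X)%N](card_imset _ enum_val_inj).
  apply/subset_leq_card/subsetP=> i; rewrite inE => uvi.
  have iI : i \in ~: I.
    by rewrite inE; apply: contra uvi => iI; rewrite u0 ?v0.
  by apply/imsetP; exists (enum_rank_in iI i); rewrite ?inE ?mxE enum_rankK_in.
have lt_E : (\dim E < #|~: I|.+1)%N.
  by have := dimvS (subvf E); rewrite dimvf /dim /= mul1n.
rewrite -dimE; apply: (@leq_bigmax_cond _ _ (fun j : 'I_ _ => j : nat) (Ordinal lt_E)).
by apply/boolp.asboolP; exists E.
Qed.

(** * Greedy union of repair sets *)

Section Greedy.
Variables (C : {vspace 'rV[F]_n}) (kappa delta : nat).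
Hypothesis locC : dim_locality C kappa delta.

Let g i := ceil_div delta (#|F| ^ i).

(** Take [S = R :\: I], with [R] a repair set of a coordinate where some shortened word is nonzero.
    That word forces [h > 0], and shortened words have equal weights on [R] and [S] because they
    vanish on [I]. *)
Lemma repair_step I : (0 < \dim (shortening C I))%N ->
  exists S h, [/\ (0 < h <= kappa)%N, [disjoint I & S],
    (\dim (shortening C (I :|: S)) + h = \dim (shortening C I))%N &
    {in shortening C I, forall x, x \notin shortening (shortening C I) S ->
      delta <= weight_on S x}%N].
Proof.
rewrite lt0n dimv_eq0 => /negPf CI_neq0.
have [x xI x_neq0] : exists2 x, x \in shortening C I & x != 0.
  by exists (vpick (shortening C I)); rewrite ?memv_pick ?vpick0 ?CI_neq0.
have [i xi] : exists i, x 0 i != 0.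
  apply/existsP; apply: contraR x_neq0; rewrite negb_exists => /forallP x0.
  by apply/eqP/rowP=> i; rewrite mxE; apply/eqP; have := x0 i; rewrite negbK.
have [R [iR dimR wtR]] := locC i.
have eqR : shortening C (I :|: R :\: I) = shortening (shortening C I) R.
  rewrite shorteningU; congr shortening; apply/setP=> j; rewrite !inE.
  by case: (j \in I).
exists (R :\: I), (\dim (restr_code (shortening C I) R)); split.
- apply/andP; split; last first.
    by apply: leq_trans dimR; apply/dimvS/limgS/shortening_sub.
  rewrite lt0n; apply: contraNneq xi => dim0.
  have := dim_restr_code (shortening C I) R; rewrite dim0 addn0 => eq_dim.
  have := eqEdim (shortening (shortening C I) R) (shortening C I).
  rewrite eq_dim leqnn shortening_sub => /eqP eq_sh.
  by move: xI; rewrite -eq_sh => /shorteningP[_ ->].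
- by rewrite disjoints_subset; apply/subsetP=> j jI; rewrite !inE jI.
- by rewrite eqR dim_restr_code.
move=> y yI yS; have /shorteningP[yC y0] := yI.
have -> : weight_on (R :\: I) y = weight_on R y.
  apply: eq_card => j; rewrite !inE; case jI: (j \in I) => //=.
  by rewrite y0 // eqxx andbF.
apply: min_dist_restr wtR yC _; apply: contra yS => /shorteningP[_ yR].
by apply/shorteningP; split=> // j /setDP[/yR].
Qed.

(* The hypothesis quantified over r is the loop invariant; r stands for the
   dimension of the partial step, which is not known until the loop ends. *)
Lemma greedy_set I lambda :
  (\dim C <= \dim (shortening C I) + lambda)%N -> (lambda <= \dim C)%N ->
  (forall r, cyclic_sum g kappa (r + (\dim C - \dim (shortening C I))) <=
             cyclic_sum g kappa r + #|I|)%N ->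
  exists I', (\dim C <= \dim (shortening C I') + lambda)%N /\
    (cyclic_sum g kappa lambda <= #|I'|)%N.
Proof.
have q_gt0 : (0 < #|F|)%N by apply/card_gt0P; exists 0.
have g_anti i j : (i <= j)%N -> (g j <= g i)%N by exact: ceil_div_expn_anti.
have griesmer_sumE h : griesmer_nat #|F| h delta = (\sum_(i < h) g i)%N by [].
have [m] := ubnP (\dim (shortening C I)); elim: m I => // m IHm I.
rewrite ltnS => le_m le_lambda lambda_le inv.
have leI := dimvS (shortening_sub C I).
have [eq_lambda|neq_lambda] := eqVneq (\dim C) (\dim (shortening C I) + lambda)%N.
  exists I; split=> //; have := inv 0%N.
  by rewrite add0n {1}eq_lambda addKn /cyclic_sum big_ord0.
have CI_gt0 : (0 < \dim (shortening C I))%N by lia.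
have [S [h [/andP[h_gt0 le_h] dis dimS wtS]]] := repair_step CI_gt0.
have cardU (T : {set 'I_n}) : T \subset S -> #|I :|: T| = (#|I| + #|T|)%N.
  move=> sTS; rewrite cardsU; have /eqP -> : I :&: T == set0; last by rewrite cards0 subn0.
  by rewrite setI_eq0; apply: disjointWr dis.
have dimS' : (\dim (shortening (shortening C I) S) + h = \dim (shortening C I))%N.
  by rewrite shorteningU.
have [le_h_lambda|lt_lambda_h] :=
    leqP (\dim C) (\dim (shortening C (I :|: S)) + lambda).
  apply: (IHm (I :|: S)) => // [|r]; first by lia.
  have -> : (r + (\dim C - \dim (shortening C (I :|: S))) =
             r + (\dim C - \dim (shortening C I)) + h)%N by lia.
  have := cyclic_sumD g_anti (r + (\dim C - \dim (shortening C I))) le_h.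
  have := griesmer_length dimS' wtS; have := inv r.
  rewrite cardU // !griesmer_sumE; lia.
(* What remains of the budget [lambda] after the dimension already spent on [I]. *)
pose r := (\dim (shortening C I) + lambda - \dim C)%N.
have le_rh : (r <= h)%N by lia.
have [J [sJS dimJ cardJ]] := griesmer_subset dimS' le_rh wtS.
exists (I :|: J); split.
  by move: dimJ; rewrite shorteningU; lia.
(* The invariant at this [r] bounds the target by [cyclic_sum g kappa r + #|I|], and [J] covers the
   first summand. *)
have := leq_cyclic_sum_tail g_anti le_rh le_h; have := inv r.
have -> : (r + (\dim C - \dim (shortening C I)) = lambda)%N by lia.
move: cardJ; rewrite cardU // !griesmer_sumE; lia.
Qed.

End Greedy.

End Shortening.

Theorem theorem1 (F : finFieldType) (n k d kappa delta : nat)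
    (C : {vspace 'rV[F]_n}) (kappa_gt0 : (0 < kappa)%N)
    (delta_gt0 : (0 < delta)%N) (codeC : linear_code C k d)
    (locC : dim_locality C kappa delta) :
  (k <= min_nat (fun lambda : nat =>
          let a := lambda %/ kappa in
          let b := lambda %% kappa in
          lambda + kopt F (n%:Z - a.+1%:Z * griesmer #|F| kappa delta
                                + griesmer #|F| (kappa - b) delta)%R d))%N.
Proof.
have q_gt0 : (0 < #|F|)%N by apply/card_gt0P; exists 0.
have [_ dimC [dC _]] := codeC.
apply/leq_min_nat => lambda /=.
have [le_k|lt_k] := leqP k lambda; first exact: leq_trans le_k (leq_addr _ _).
have [I0 [dimI0 cardI0]] : exists I0 : {set 'I_n},
    (\dim C <= \dim (shortening C I0) + lambda)%N /\
    (cyclic_sum (fun i => ceil_div delta (#|F| ^ i)) kappa lambda <= #|I0|)%N.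
  apply: (greedy_set locC (I := set0)); rewrite ?shortening_set0 ?leq_addr //.
    by rewrite dimC ltnW.
  by move=> r; rewrite subnn addn0 leq_addr.
(* Trimming to the exact size makes the shortened length equal to the argument of [kopt], which is
   thus nonnegative; a smaller set only enlarges the shortening. *)
have [I sI cardI] : exists2 I : {set 'I_n}, I \subset I0 &
    #|I| = cyclic_sum (fun i => ceil_div delta (#|F| ^ i)) kappa lambda.
  have /card_geqP[s [s_uniq <- sI0]] := cardI0; exists [set i in s].
    by apply/subsetP=> i; rewrite inE => /sI0.
  by rewrite cardsE; apply/card_uniqP.
have dimI := dimvS (shorteningS C sI).
have := shortening_kopt I dC.
have := cyclic_sumE (fun i => ceil_div delta (#|F| ^ i))
  (lambda %/ kappa) (ltnW (ltn_pmod lambda kappa_gt0)).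
rewrite -divn_eq -cardI => sumE.
rewrite !griesmerE //.
have -> : (n%:Z - (lambda %/ kappa).+1%:Z * (griesmer_nat #|F| kappa delta)%:Z
    + (griesmer_nat #|F| (kappa - lambda %% kappa) delta)%:Z)%R = #|~: I|%:Z.
  have cardC : (#|I| + #|~: I| = n)%N by rewrite cardsC card_ord.
  by rewrite -PoszM /griesmer_nat -sumE; lia.
rewrite /kopt; lia.
Qed.
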